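(* Let $V\subset Q$ be the base of a semistable chart adapted to $Y_1$, fix $\theta\in S^1$, and let $0<r\ll1$. In the local semistable model $t=uv$, the family of equal-modulus necks $$N_{V,\rho,\theta}:=\bigl\{(u,v,q)\in\mathcal V_{\rho e^{i\theta}}\mid|u|=|v|=\sqrt\rho\bigr\},\qquad0<\rho\le r,$$ fits together with the local fixed-phase circle $P_{V,\theta}\to V$ at $\rho=0$ into a topological principal $S^1$-bundle over $[0,r]\times V$. In particular, each neck $N_{V,\rho,\theta}$ is canonically homeomorphic to the local fixed-phase circle $P_{V,\theta}$, and this homeomorphism is compatible with the $S^1$-action and varies continuously in $\rho$. In particular, in the local model, the space $$W_{V,r,\theta}:=\bigsqcup_{0\le\rho\le r}N_{V,\rho,\theta}$$ (with $N_{V,0,\theta}:=P_{V,\theta}$) deformation-retracts onto $P_{V,\theta}$ via the map $(\rho,q,\eta)\mapsto(0,q,\eta)$, where $\eta:=v/|v|\in S^1$ is the phase coordinate.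
   Context: $Q\simeq\mathbb P^1\times\mathbb P^1$ is the double locus of the normal crossings threefold $Z_0=\widetilde Z_1\cup_Q\widetilde Z_2$, obtained by gluing two blow-ups $\widetilde Z_i=\mathrm{Bl}_{\ell_i}(Z_i)$ of twistor spaces along twistor lines, along their exceptional divisors by an isomorphism exchanging the two rulings; $Y_1:=\widetilde Z_1$. A semistable chart adapted to $Y_1$ along $Q$ is a neighbourhood $V\subset Q$, an analytic space $\mathcal V$ and a flat map $\pi_V:\mathcal V\to\Delta$ to a disc such that, analytically near $V$, $\mathcal V$ has coordinates $(u,v,z_3,\dots,z_n,t)$ with equation $t=uv$, $\mathcal V_0=\{uv=0\}$, $V=\{u=v=0\}$, and the branch $\{u=0\}\subset\mathcal V_0$ is identified with a neighbourhood of $V$ in $Y_1$. Write $\mathcal V_t=\pi_V^{-1}(t)$ and denote points of $\mathcal V_t$ near $V$ by $(u,v,q)$ with $q\in V$ and $uv=t$. The local fixed-phase circle is the principal $S^1$-bundle $P_{V,\theta}\to V$ whose fibre over each point of $V$ is $\{(\rho_1,\rho_2)\in S^1\times S^1\mid\rho_1\rho_2=e^{i\theta}\}$, with action $a\cdot(\rho_1,\rho_2)=(a\rho_1,a^{-1}\rho_2)$ (the fibre over $(0,\theta)$ of the Kato--Nakayama space of the chart, restricted to $V$). On the neck the phases are $\rho_1=u/|u|$, $\rho_2=v/|v|=\eta$, and $S^1$ acts correspondingly; on $P_{V,\theta}$, $\eta=\rho_2$. *)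

(* Defs.v *)
From HB Require Import structures.
From mathcomp Require Import all_boot all_order all_algebra complex.
From mathcomp Require Import all_classical all_reals all_analysis.

Set Implicit Arguments.
Unset Strict Implicit.
Unset Printing Implicit Defensive.

Import Order.TTheory GRing.Theory Num.Theory.
Import numFieldNormedType.Exports.
Local Open Scope classical_set_scope.
Local Open Scope ring_scope.
Local Open Scope complex_scope.

(* The usual topology of the complex numbers, given by the norm. *)
HB.instance Definition _ (R : realType) := NormedModule.copy R[i] (R[i])^o.

(** * Homeomorphisms, principal circle bundles, deformation retractions

    Spaces are subsets of ambient topological spaces, with the subspace
    topology. *)

Definition inverse_homeos (T U : topologicalType) (A : set T) (B : set U)
    (f : T -> U) (g : U -> T) : Prop :=
  [/\ set_fun A B f /\ set_fun B A g,
      forall x, A x -> g (f x) = x,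
      forall y, B y -> f (g y) = y,
      {within A, continuous f} &
      {within B, continuous g}].

Definition homeo_on (T U : topologicalType) (A : set T) (B : set U)
    (f : T -> U) : Prop :=
  exists g : U -> T, inverse_homeos A B f g.

Definition circle {R : realType} : set R[i] := [set a | `|a| = 1].

Definition cis (R : realType) (theta : R) : R[i] :=
  Complex (cos theta) (sin theta).

Record principal_circle_bundle (R : realType) (T U : topologicalType)
    (E : set T) (B : set U) (p : T -> U) (act : R[i] -> T -> T) : Prop := {
  pcb_proj : set_fun E B p;
  pcb_proj_cont : {within E, continuous p};
  pcb_act : forall a x, circle a -> E x -> E (act a x);
  pcb_act1 : forall x, E x -> act 1 x = x;
  pcb_actM : forall a b x, circle a -> circle b -> E x ->
    act (a * b) x = act a (act b x);
  pcb_act_cont :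
    {within circle `*` E, continuous (fun ax : R[i] * T => act ax.1 ax.2)};
  pcb_act_proj : forall a x, circle a -> E x -> p (act a x) = p x;
  pcb_triv : forall b, B b -> exists O : set U, [/\ open O, O b &
    exists phi : U * R[i] -> T,
      [/\ homeo_on ((B `&` O) `*` circle) (E `&` p @^-1` O) phi,
          forall y a, (B `&` O) y -> circle a -> p (phi (y, a)) = y &
          forall y a c, (B `&` O) y -> circle a -> circle c ->
            phi (y, c * a) = act c (phi (y, a))]] }.

(* [f] is the end map of a strong deformation retraction of [E] onto [A]. *)
Definition deformation_retraction (R : realType) (T : topologicalType)
    (E A : set T) (f : T -> T) : Prop :=
  A `<=` E /\
  exists H : R * T -> T,
    [/\ {within `[0, 1] `*` E, continuous H},
        set_fun (`[0, 1] `*` E) E H,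
        forall x, E x -> H (0, x) = x,
        forall x, E x -> A (f x) /\ H (1, x) = f x &
        forall s x, `[0, 1]%classic s -> A x -> H (s, x) = x].

(** * Complex analytic spaces *)

Section ComplexSpaces.
Variable R : realType.
Local Notation C := R[i].

(* Complex differentiability (over [C]) on a neighbourhood of [w]. *)
Definition holomorphic_at (E : normedModType C) (w : E) (G : E -> C) : Prop :=
  \forall w' \near w, differentiable G w'.

Definition analytic_model (E : normedModType C) (A : set E) : Prop :=
  exists (D : set E) (k : nat) (F : 'I_k -> E -> C),
    [/\ open D,
        forall i w, D w -> holomorphic_at w (F i) &
        A = D `&` [set w | forall i, F i w = 0]].

(* [hol x] is the set of functions that are holomorphic near [x]. *)
Record analytic_chart (T : topologicalType) (hol : T -> set (T -> C))
    (E : normedModType C) (U : set T) (A : set E)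
    (phi : T -> E) (psi : E -> T) : Prop := {
  ac_open : open U;
  ac_homeo : inverse_homeos U A phi psi;
  ac_hol : forall y g, U y ->
    hol y g <-> exists2 G : E -> C, holomorphic_at (phi y) G &
                  \forall y' \near y, g y' = G (phi y') }.

(* Reduced complex spaces: the structure sheaf is a sheaf of functions, encoded
   by its germs. *)
Record complexSpace := ComplexSpace {
  cs_carrier :> topologicalType;
  cs_hol : cs_carrier -> set (cs_carrier -> C);
  cs_hausdorff : hausdorff_space cs_carrier;
  cs_model : forall x, exists (N : nat) (U : set cs_carrier)
      (A : set 'rV[C]_N) (phi : cs_carrier -> 'rV[C]_N)
      (psi : 'rV[C]_N -> cs_carrier),
    [/\ U x, analytic_model A & analytic_chart cs_hol U A phi psi] }.

(* Flatness at [x] of the local ring of [X] over that of the complex line at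
   [p x], by the equational criterion: every relation
   [sum_i a_i m_i = 0] with coefficients in the base is a consequence of
   relations in the base. *)
Definition flat_at (X : complexSpace) (p : X -> C) (x : X) : Prop :=
  forall (k : nat) (a : 'I_k -> C -> C) (m : 'I_k -> X -> C),
    (forall i, holomorphic_at (p x) (a i)) ->
    (forall i, cs_hol x (m i)) ->
    (\forall y \near x, \sum_i a i (p y) * m i y = 0) ->
  exists (l : nat) (b : 'I_k -> 'I_l -> C -> C) (m' : 'I_l -> X -> C),
    [/\ forall i j, holomorphic_at (p x) (b i j),
        forall j, cs_hol x (m' j),
        forall i, \forall y \near x, m i y = \sum_j b i j (p y) * m' j y &
        forall j, \forall t \near p x, \sum_i a i t * b i j t = 0].

(* The two affine charts of the projective line, seen as the Riemann sphere. *)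
Definition P1_chart (s : bool) (a : C) : one_point_compactification C :=
  if s then Some a else if a == 0 then None else Some a^-1.

(* [Q], with the functions that are locally restrictions of holomorphic
   functions on [X], is isomorphic to P^1 x P^1. *)
Definition is_P1xP1 (X : complexSpace) (Q : set X) : Prop :=
  exists h : one_point_compactification C * one_point_compactification C -> X,
    homeo_on setT Q h /\
    forall (s1 s2 : bool) (a : C * C) (G : C * C -> C),
      let c b := h (P1_chart s1 b.1, P1_chart s2 b.2) in
      holomorphic_at a G <->
      exists2 F : X -> C, cs_hol (c a) F & \forall b \near a, G b = F (c b).

(** * Semistable charts *)

(* [sc_k] is n - 2, the number of coordinates z_3, ..., z_n along V.  The
   coordinates (u, v, z, t), with t the value of the projection to the disc,
   identify the neighbourhood [sc_nbhd] of V with the hypersurface t = uv over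
   the product of two discs of radius [sc_eps] and of the range of z; this is
   what makes (u, v, q), with |u|, |v| < eps and q in V, denote a point of the
   total space, uniformly in q. *)
Record semistable_chart (Y : complexSpace) (Q : set Y) := {
  sc_base : set Y;
  sc_base_sub : sc_base `<=` Q;
  sc_base_open : exists2 O : set Y, open O & sc_base = Q `&` O;

  sc_space : complexSpace;
  sc_pi : sc_space -> C;
  sc_delta : R;
  sc_delta_gt0 : 0 < sc_delta;
  sc_pi_disc : forall x, `|sc_pi x| < sc_delta%:C;
  sc_pi_hol : forall x, cs_hol x sc_pi;
  sc_pi_flat : forall x, flat_at sc_pi x;

  sc_k : nat;
  sc_eps : R;
  sc_eps_gt0 : 0 < sc_eps;
  sc_range : set 'rV[C]_sc_k;
  sc_range_open : open sc_range;
  sc_nbhd : set sc_space;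
  sc_u : sc_space -> C;
  sc_v : sc_space -> C;
  sc_z : sc_space -> 'rV[C]_sc_k;
  sc_point : C * C * 'rV[C]_sc_k * C -> sc_space;
  sc_coords :
    analytic_chart (@cs_hol sc_space) sc_nbhd
      [set w : C * C * 'rV[C]_sc_k * C |
        [/\ `|w.1.1.1| < sc_eps%:C, `|w.1.1.2| < sc_eps%:C,
            sc_range w.1.2 & w.2 = w.1.1.1 * w.1.1.2]]
      (fun x => (sc_u x, sc_v x, sc_z x, sc_pi x))
      sc_point;

  (* the identification of the branch u = 0 with a neighbourhood of V in Y,
     under which V is the locus u = v = 0 *)
  sc_glue : sc_space -> Y;
  sc_unglue : Y -> sc_space;
  sc_glue_nbhd : set Y;
  sc_glue_nbhd_open : open sc_glue_nbhd;
  sc_glue_homeo :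
    inverse_homeos (sc_nbhd `&` [set x | sc_u x = 0]) sc_glue_nbhd
      sc_glue sc_unglue;
  sc_glue_hol : forall x (G : Y -> C), sc_nbhd x -> sc_u x = 0 ->
    cs_hol (sc_glue x) G <->
    exists2 F : sc_space -> C, cs_hol x F &
      \forall x' \near x, sc_u x' = 0 -> G (sc_glue x') = F x';
  sc_glue_base :
    sc_glue @` (sc_nbhd `&` [set x | sc_u x = 0 /\ sc_v x = 0]) = sc_base }.

End ComplexSpaces.

Arguments sc_point {R Y Q} s _.
Arguments sc_unglue {R Y Q} s _.
Arguments sc_nbhd {R Y Q} s _.
Arguments sc_base {R Y Q} s _.

(** * Necks and the fixed-phase circle *)

Section Necks.
Variables (R : realType) (Y : complexSpace R) (Q : set Y).
Variable X : semistable_chart Q.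
Local Notation C := R[i].

Definition sc_q (x : sc_space X) : Y := sc_glue (sc_point X (0, 0, sc_z x, 0)).

Definition neck (rho theta : R) : set (sc_space X) :=
  sc_nbhd X `&`
  [set x | [/\ sc_pi x = rho%:C * cis theta,
               `|sc_u x| = (Num.sqrt rho)%:C &
               `|sc_v x| = (Num.sqrt rho)%:C]].

Definition phases (x : sc_space X) : C * C :=
  (sc_u x / `|sc_u x|, sc_v x / `|sc_v x|).

Definition neck_act (a : C) (x : sc_space X) : sc_space X :=
  sc_point X (a * sc_u x, a^-1 * sc_v x, sc_z x, sc_pi x).

Definition phase_act (a : C) (s : C * C) : C * C := (a * s.1, a^-1 * s.2).

Definition fixed_phase_circle (theta : R) : set (Y * (C * C)) :=
  [set p | [/\ sc_base X p.1, circle p.2.1, circle p.2.2 &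
               p.2.1 * p.2.2 = cis theta]].

Definition circle_act (a : C) (p : Y * (C * C)) : Y * (C * C) :=
  (p.1, phase_act a p.2).

Definition neck_to_circle (x : sc_space X) : Y * (C * C) := (sc_q x, phases x).

(* Points of the total space W are written (rho, (x, (rho_1, rho_2))).  Here
   (x, (rho_1, rho_2)) is a point of the Kato--Nakayama space of the chart,
   {u(x) = |u(x)| rho_1, v(x) = |v(x)| rho_2}, which is a subspace of
   X x S^1 x S^1; W carries the resulting subspace topology. *)
Definition neck_incl (rho : R) (x : sc_space X) : R * (sc_space X * (C * C)) :=
  (rho, (x, phases x)).

Definition circle_incl (p : Y * (C * C)) : R * (sc_space X * (C * C)) :=
  (0, (sc_unglue X p.1, p.2)).

Definition neck_total (r theta : R) : set (R * (sc_space X * (C * C))) :=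
  (\bigcup_(rho in `]0, r]) (neck_incl rho @` neck rho theta))
  `|` circle_incl @` fixed_phase_circle theta.

Definition total_proj (w : R * (sc_space X * (C * C))) : R * Y :=
  (w.1, sc_q w.2.1).

Definition total_act (a : C) (w : R * (sc_space X * (C * C))) :
    R * (sc_space X * (C * C)) :=
  (w.1, (neck_act a w.2.1, phase_act a w.2.2)).

Definition total_to_circle (w : R * (sc_space X * (C * C))) :
    R * (Y * (C * C)) :=
  (w.1, (sc_q w.2.1, w.2.2)).

(* The coordinates (rho, q, eta). *)
Definition total_coords (w : R * (sc_space X * (C * C))) : R * Y * C :=
  (w.1, sc_q w.2.1, w.2.2.2).

Definition total_retract (w : R * (sc_space X * (C * C))) :
    R * (sc_space X * (C * C)) :=
  circle_incl (sc_q w.2.1, w.2.2).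

End Necks.

Arguments neck {R Y Q} X rho theta _.
Arguments fixed_phase_circle {R Y Q} X theta _.
Arguments circle_incl {R Y Q} X p.
Arguments neck_total {R Y Q} X r theta _.

(* Main.v *)
Require Import Defs.
From HB Require Import structures.
From mathcomp Require Import all_boot all_order all_algebra complex.
From mathcomp Require Import all_classical all_reals all_analysis.

Set Implicit Arguments.
Unset Strict Implicit.
Unset Printing Implicit Defensive.

Import Order.TTheory GRing.Theory Num.Theory.
Import numFieldNormedType.Exports.
Local Open Scope classical_set_scope.
Local Open Scope ring_scope.
Local Open Scope complex_scope.

(** The neck over [rho] is cut out by [|u| = |v| = sqrt rho] and
    [uv = rho * cis theta], so a point of it is determined by its coordinate
    [z], that is by its point [q] of the base, and by its two phases:
    [u = sqrt rho * rho_1] and [v = sqrt rho * rho_2] with [rho_1 * rho_2 = cis theta].  These two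
    equations keep their meaning at [rho = 0], where they say that the point
    lies on [u = v = 0] and leave the phases free; this is exactly the
    fixed-phase circle.  Thus the total space [W] has the uniform description
    of [neck_totalP], with no case distinction on [rho].

    Solving the equations gives an explicit inverse [circle_to_total] of
    [total_to_circle], continuous up to [rho = 0] because [sqrt] is; hence
    [W] is homeomorphic to [[0, r] x P] ([total_homeo]).  The condition
    [r < eps ^ 2] ensures that [sqrt rho] stays in the discs where the chart
    is defined, uniformly in [q].  Since [P] is the product of the base with
    the torsor of pairs of phases, which [eta = rho_2] identifies with the
    circle ([phase_torsor_homeo]), the bundle is globally trivial.

    All the other assertions are read off through this homeomorphism: the
    necks and the fixed-phase circle are its slices over [rho > 0] and
    [rho = 0], the action multiplies the phases by [(a, a^-1)], and the
    deformation retraction scales [rho] by [1 - s] in [[0, r] x P]. *)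

(** * Continuity within a subset and mutually inverse homeomorphisms *)

Section WithinContinuity.
Variables (T U V : topologicalType) (A : set T).

Lemma within_comp (B : set U) (f : T -> U) (g : U -> V) :
  set_fun A B f -> {within A, continuous f} -> {within B, continuous g} ->
  {within A, continuous (fun x => g (f x))}.
Proof.
move=> fAB /subspace_continuousP cf /subspace_continuousP cg.
apply/subspace_continuousP => x Ax.
have h : f @ within A (nbhs x) --> within B (nbhs (f x)).
  move=> S BS; suff : nbhs x [set y | A y -> S (f y)] by [].
  have H : nbhs x [set y | A y -> B (f y) -> S (f y)] by exact: cf x Ax _ BS.
  by apply: filterS H => y fS Ay; exact: fS Ay (fAB _ Ay).
exact: cvg_comp h (cg _ (fAB _ Ax)).
Qed.

Lemma within_compT (f : T -> U) (g : U -> V) :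
  continuous g -> {within A, continuous f} ->
  {within A, continuous (fun x => g (f x))}.
Proof.
move=> cg cf; apply: (within_comp (B := setT)) cf _ => //.
exact: continuous_subspaceT.
Qed.

Lemma within_eq (f g : T -> U) :
  (forall x, A x -> f x = g x) ->
  {within A, continuous f} -> {within A, continuous g}.
Proof.
move=> fg; apply: subspace_eq_continuous => x; rewrite inE; exact: fg.
Qed.

Lemma within_cst (c : U) : {within A, continuous (fun=> c)}.
Proof. by apply: continuous_subspaceT => x; exact: cvg_cst. Qed.

Lemma within_id : {within A, continuous (fun x => x)}.
Proof. by apply: continuous_subspaceT => x; exact: cvg_id. Qed.

Lemma within_pair (f : T -> U) (g : T -> V) :
  {within A, continuous f} -> {within A, continuous g} ->
  {within A, continuous (fun x => (f x, g x))}.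
Proof.
move=> /subspace_continuousP cf /subspace_continuousP cg.
apply/subspace_continuousP => x Ax; apply: cvg_pair; [exact: cf|exact: cg].
Qed.

Lemma within_fst (f : T -> U * V) :
  {within A, continuous f} -> {within A, continuous (fun x => (f x).1)}.
Proof.
move=> /subspace_continuousP cf; apply/subspace_continuousP => x Ax.
apply: cvg_comp (cf x Ax) _; exact: cvg_fst.
Qed.

Lemma within_snd (f : T -> U * V) :
  {within A, continuous f} -> {within A, continuous (fun x => (f x).2)}.
Proof.
move=> /subspace_continuousP cf; apply/subspace_continuousP => x Ax.
apply: cvg_comp (cf x Ax) _; exact: cvg_snd.
Qed.

End WithinContinuity.

Section WithinContinuityField.
Variables (K : numFieldType) (T : topologicalType) (A : set T).

Lemma within_mul (f g : T -> K) :
  {within A, continuous f} -> {within A, continuous g} ->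
  {within A, continuous (fun x => f x * g x)}.
Proof.
move=> cf cg.
exact: within_compT (@mul_continuous K) (within_pair cf cg).
Qed.

Lemma within_inv (f : T -> K) :
  (forall x, A x -> f x != 0) -> {within A, continuous f} ->
  {within A, continuous (fun x => (f x)^-1)}.
Proof.
move=> f0 cf; apply: (within_comp (B := [set x | x != 0])) cf _ => //.
apply: continuous_in_subspaceT => x; rewrite inE; exact: inv_continuous.
Qed.

End WithinContinuityField.

Lemma real_complex_continuous (R : realType) :
  continuous (fun x : R => x%:C : R[i]).
Proof.
move=> x; apply/cvgrPdist_lt => e e0.
have [r r0 ->] : exists2 r : R, 0 < r & e = r%:C.
  by case: e e0 => a b; rewrite ltcE /= => /andP[/eqP -> a0]; exists a.
near=> y.
rewrite -rmorphB normc_def /= expr0n addr0 sqrtr_sqr ltcR.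
by near: y; apply: cvgr_dist_lt.
Unshelve. all: by end_near. Qed.

Section InverseHomeos.
Variables (T U V : topologicalType) (A : set T) (B : set U) (C : set V).

Lemma inverse_homeos_sym f g :
  inverse_homeos A B f g -> inverse_homeos B A g f.
Proof. by case=> -[fAB gBA] fK gK cf cg; split. Qed.

Lemma inverse_homeos_comp f g f' g' :
  inverse_homeos A B f g -> inverse_homeos B C f' g' ->
  inverse_homeos A C (fun x => f' (f x)) (fun y => g (g' y)).
Proof.
case=> -[fAB gBA] fK gK cf cg [[fBC gCB] fK' gK' cf' cg']; split.
- by split=> x /=; [move/fAB/fBC|move/gCB/gBA].
- by move=> x Ax; rewrite fK' ?fK //; exact: fAB.
- by move=> x Cx; rewrite gK ?gK' //; exact: gCB.
- exact: within_comp fAB cf cf'.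
- exact: within_comp gCB cg' cg.
Qed.

Lemma inverse_homeos_restrict (A' : set T) (B' : set U) f g :
  A' `<=` A -> B' `<=` B -> set_fun A' B' f -> set_fun B' A' g ->
  inverse_homeos A B f g -> inverse_homeos A' B' f g.
Proof.
move=> sA sB fAB' gBA' [_ fK gK cf cg]; split => //.
- by move=> x /sA; exact: fK.
- by move=> x /sB; exact: gK.
- exact: continuous_subspaceW cf.
- exact: continuous_subspaceW cg.
Qed.

Lemma inverse_homeos_eq f f' g :
  (forall x, A x -> f x = f' x) ->
  inverse_homeos A B f g -> inverse_homeos A B f' g.
Proof.
move=> ff' [[fAB gBA] fK gK cf cg]; split => //.
- by split => // x Ax; rewrite -ff' //; exact: fAB.
- by move=> x Ax; rewrite -ff' // fK.
- by move=> x Bx; rewrite -ff' ?gK //; exact: gBA.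
- exact: within_eq ff' cf.
Qed.

End InverseHomeos.

(** Homeomorphisms over a parameter space [S] restrict to the fibres over [c];
    this is how a statement on each neck follows from one on their family. *)
Lemma inverse_homeos_slice (S T U : topologicalType) (A : set (S * T))
    (B : set (S * U)) f g (c : S) :
  inverse_homeos A B f g ->
  (forall x, A x -> (f x).1 = x.1) -> (forall y, B y -> (g y).1 = y.1) ->
  inverse_homeos [set x | A (c, x)] [set y | B (c, y)]
    (fun x => (f (c, x)).2) (fun y => (g (c, y)).2).
Proof.
move=> [[fAB gBA] fK gK cf cg] f1 g1.
have fE x : A (c, x) -> f (c, x) = (c, (f (c, x)).2).
  by move=> Ax; rewrite [LHS]surjective_pairing f1.
have gE y : B (c, y) -> g (c, y) = (c, (g (c, y)).2).
  by move=> Bx; rewrite [LHS]surjective_pairing g1.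
have cpair (W : topologicalType) (D : set (S * W)) :
    {within [set x | D (c, x)], continuous (fun x => (c, x))}.
  apply: continuous_subspaceT => x; apply: cvg_pair => //; exact: cvg_cst.
split.
- by split=> x /= h; [rewrite -fE //; exact: fAB|rewrite -gE //; exact: gBA].
- by move=> x /= Ax; rewrite -fE // fK.
- by move=> x /= Ax; rewrite -gE // gK.
- by apply: within_snd; apply: within_comp (cpair _ A) cf.
- by apply: within_snd; apply: within_comp (cpair _ B) cg.
Qed.

(** Changes the fibre coordinate of a product, reassociating it from the
    coordinates [(rho, q, eta)] to the pairs [(rho, (q, phases))]. *)
Lemma inverse_homeos_fibre (S T U V : topologicalType) (A : set S) (B : set T)
    (F : set U) (G : set V) f g :
  inverse_homeos F G f g ->
  inverse_homeos (A `*` B `*` F) (A `*` (B `*` G))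
    (fun x => (x.1.1, (x.1.2, f x.2))) (fun y => (y.1, y.2.1, g y.2.2)).
Proof.
move=> [[fFG gGF] fK gK cf cg]; split.
- split.
  + by move=> [[a b] c] [[/= Aa Bb] Fc]; do 2 split => //; exact: fFG.
  + by move=> [a [b c]] [/= Aa [Bb Gc]]; split=> //; exact: gGF.
- by move=> [[a b] c] [/= _ /fK ->].
- by move=> [a [b c]] [/= _ [_ /gK ->]].
- have i1 := within_fst (@within_id _ (A `*` B `*` F)).
  have i2 := within_snd (@within_id _ (A `*` B `*` F)).
  apply: within_pair (within_fst i1) (within_pair (within_snd i1) _).
  by apply: (within_comp _ i2 cf) => x [].
- have i1 := within_fst (@within_id _ (A `*` (B `*` G))).
  have i2 := within_snd (@within_id _ (A `*` (B `*` G))).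
  apply: within_pair (within_pair i1 (within_fst i2)) _.
  by apply: (within_comp _ (within_snd i2) cg) => x [_ []].
Qed.

(** * The circle and the torsor of phases *)

Section Circle.
Variable R : realType.
Local Notation C := R[i].

Lemma circle_cis (theta : R) : circle (cis theta).
Proof. by rewrite /circle /= normc_def /= cos2Dsin2 sqrtr1. Qed.

Lemma circleM (a b : C) : circle a -> circle b -> circle (a * b).
Proof. by rewrite /circle /= normrM => -> ->; rewrite mulr1. Qed.

Lemma circleV (a : C) : circle a -> circle a^-1.
Proof. by rewrite /circle /= normfV => ->; rewrite invr1. Qed.

Lemma circle_neq0 (a : C) : circle a -> a != 0.
Proof. by rewrite /circle /= -normr_eq0 => ->; exact: oner_neq0. Qed.

Lemma norm_sqrtC (x : R) : `|(Num.sqrt x)%:C : C| = (Num.sqrt x)%:C.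
Proof. by rewrite ger0_norm // lecR sqrtr_ge0. Qed.

Lemma sqrtC_neq0 (rho : R) : 0 < rho -> (Num.sqrt rho)%:C != 0 :> C.
Proof. by move=> h; rewrite fmorph_eq0 gt_eqF // sqrtr_gt0. Qed.

Lemma sqrtCM (x : R) : 0 <= x ->
  (Num.sqrt x)%:C * (Num.sqrt x)%:C = x%:C :> C.
Proof. by move=> x0; rewrite -rmorphM /= -expr2 sqr_sqrtr. Qed.

(** The fibre of the fixed-phase circle, a torsor under the action
    [phase_act] of the circle. *)
Definition phase_torsor (theta : R) : set (C * C) :=
  [set s | [/\ circle s.1, circle s.2 & s.1 * s.2 = cis theta]].

Lemma phase_torsor_act theta a s : circle a -> phase_torsor theta s ->
  phase_torsor theta (phase_act a s).
Proof.
move=> a1 [s1 s2 s12]; split=> /=.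
- exact: circleM.
- by apply: circleM => //; exact: circleV.
- by rewrite mulrACA mulfV ?mul1r //; exact: circle_neq0.
Qed.

(** The phase [eta = rho_2] determines [rho_1 = cis theta / eta], so it is a
    global coordinate on the torsor. *)
Lemma phase_torsor_homeo theta :
  inverse_homeos circle (phase_torsor theta)
    (fun eta : C => (cis theta / eta, eta)) snd.
Proof.
split.
- split=> [eta h|s []] //; split=> //=.
  + by apply: circleM; [exact: circle_cis|exact: circleV].
  + by rewrite divfK //; exact: circle_neq0.
- by [].
- by move=> [s1 s2] [/= _ h2 <-]; rewrite mulfK //; exact: circle_neq0.
- apply: within_pair; last exact: within_id.
  apply: within_mul.
    exact: within_cst.
  apply: (within_inv (f := id)); first by move=> x; exact: circle_neq0.
  exact: within_id.
- by apply: within_snd; apply: continuous_subspaceT => x; exact: cvg_id.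
Qed.

End Circle.

(** * Coordinates of a semistable chart and projection to the base *)

Section Chart.
Variables (R : realType) (Y : complexSpace R) (Q : set Y).
Variable X : semistable_chart Q.
Local Notation C := R[i].

Definition chart_range : set (C * C * 'rV[C]_(sc_k X) * C) :=
  [set w | [/\ `|w.1.1.1| < (sc_eps X)%:C, `|w.1.1.2| < (sc_eps X)%:C,
               sc_range w.1.2 & w.2 = w.1.1.1 * w.1.1.2]].

Definition chart_coords (x : sc_space X) := (sc_u x, sc_v x, sc_z x, sc_pi x).

Lemma chart_homeo :
  inverse_homeos (sc_nbhd X) chart_range chart_coords (sc_point X).
Proof. exact: ac_homeo (sc_coords X). Qed.

Lemma chart_coords_range x : sc_nbhd X x -> chart_range (chart_coords x).
Proof. by case: chart_homeo => -[h _] _ _ _ _; exact: h. Qed.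

Lemma sc_pointK x : sc_nbhd X x ->
  sc_point X (sc_u x, sc_v x, sc_z x, sc_pi x) = x.
Proof. by case: chart_homeo => _ h _ _ _; exact: h. Qed.

Lemma sc_nbhd_point w : chart_range w -> sc_nbhd X (sc_point X w).
Proof. by case: chart_homeo => -[_ h] _ _ _ _; exact: h. Qed.

Lemma chart_coords_point w : chart_range w -> 
  [/\ sc_u (sc_point X w) = w.1.1.1, sc_v (sc_point X w) = w.1.1.2,
      sc_z (sc_point X w) = w.1.2 & sc_pi (sc_point X w) = w.2].
Proof.
case: chart_homeo => _ _ h _ _ /h; case: w => -[[u v] z] t /=.
by rewrite /chart_coords => -[-> -> -> ->].
Qed.

Lemma chart_range0 x : sc_nbhd X x -> chart_range (0, 0, sc_z x, 0).
Proof.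
move=> /chart_coords_range[_ _ /= zx _].
by split; rewrite /= ?normr0 ?mulr0 ?ltcR ?sc_eps_gt0.
Qed.

Lemma within_point (T : topologicalType) (A : set T) (u v : T -> C)
    (z : T -> 'rV[C]_(sc_k X)) (t : T -> C) :
  (forall x, A x -> chart_range (u x, v x, z x, t x)) ->
  {within A, continuous u} -> {within A, continuous v} ->
  {within A, continuous z} -> {within A, continuous t} ->
  {within A, continuous (fun x => sc_point X (u x, v x, z x, t x))}.
Proof.
move=> h cu cv cz ct; case: chart_homeo => _ _ _ _ cp.
apply: (within_comp (B := chart_range)) cp => //.
exact: within_pair (within_pair (within_pair cu cv) cz) ct.
Qed.

Lemma within_chart (T : topologicalType) (A : set T) (f : T -> sc_space X) :
  set_fun A (sc_nbhd X) f -> {within A, continuous f} ->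
  [/\ {within A, continuous (fun x => sc_u (f x))},
      {within A, continuous (fun x => sc_v (f x))},
      {within A, continuous (fun x => sc_z (f x))} &
      {within A, continuous (fun x => sc_pi (f x))}].
Proof.
move=> fA cf; case: chart_homeo => _ _ _ cc _.
have cfc := within_comp fA cf cc.
split.
- exact: within_fst (within_fst (within_fst cfc)).
- exact: within_snd (within_fst (within_fst cfc)).
- exact: within_snd (within_fst cfc).
- exact: within_snd cfc.
Qed.

(** The copy of the base of the chart inside its total space. *)
Definition double_locus : set (sc_space X) :=
  sc_nbhd X `&` [set x | sc_u x = 0 /\ sc_v x = 0].

(** The gluing of the branch [u = 0], restricted to the locus [v = 0]. *)
Lemma double_locus_homeo :
  inverse_homeos double_locus (sc_base X) (@sc_glue _ _ _ X) (sc_unglue X).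
Proof.
have sub : double_locus `<=` sc_nbhd X `&` [set x | sc_u x = 0].
  by move=> x [? []].
have [[gA _] gK _ _ _] := sc_glue_homeo X.
apply: inverse_homeos_restrict (sc_glue_homeo X) => //.
- by move=> y; rewrite -sc_glue_base => -[x /sub xA <-]; exact: gA.
- by move=> x xA; rewrite -sc_glue_base; exists x.
- by move=> y; rewrite -sc_glue_base => -[x xA <-]; rewrite /= gK //; exact: sub.
Qed.

(** On the double locus [t = uv] vanishes as well, so that only the coordinate
    [z] remains. *)
Lemma double_locus_point x : double_locus x <->
  sc_nbhd X x /\ x = sc_point X (0, 0, sc_z x, 0).
Proof.
split=> [[nx [u0 v0]]|[nx xE]].
  split=> //; rewrite -[LHS](sc_pointK nx) u0 v0.
  by have [_ _ _ /= ->] := chart_coords_range nx; rewrite u0 mul0r.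
have [u0 v0 _ _] := chart_coords_point (chart_range0 nx).
by split; rewrite // xE.
Qed.

Lemma double_locus_sc_q x : sc_nbhd X x ->
  double_locus (sc_point X (0, 0, sc_z x, 0)).
Proof.
move=> nx; have [u0 v0 _ _] := chart_coords_point (chart_range0 nx).
by split => //; exact/sc_nbhd_point/chart_range0.
Qed.

Lemma sc_q_base x : sc_nbhd X x -> sc_base X (sc_q x).
Proof. by case: double_locus_homeo => -[h _] _ _ _ _ /double_locus_sc_q/h. Qed.

Lemma unglue_sc_q x : sc_nbhd X x ->
  sc_unglue X (sc_q x) = sc_point X (0, 0, sc_z x, 0).
Proof. by case: double_locus_homeo => _ h _ _ _ /double_locus_sc_q/h. Qed.

Lemma sc_z_sc_q x : sc_nbhd X x -> sc_z (sc_unglue X (sc_q x)) = sc_z x.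
Proof.
move=> nx; rewrite unglue_sc_q //.
by have [] := chart_coords_point (chart_range0 nx).
Qed.

Lemma double_locus_unglue q : sc_base X q -> double_locus (sc_unglue X q).
Proof. by case: double_locus_homeo => -[_ h] _ _ _ _ /h. Qed.

(** The projection to the base depends on [z] only, and [z] is injective on the
    double locus. *)
Lemma sc_q_eq x q : sc_nbhd X x -> sc_base X q ->
  sc_z x = sc_z (sc_unglue X q) -> sc_q x = q.
Proof.
move=> nx bq zE; rewrite /sc_q zE.
have /double_locus_point[_ <-] := double_locus_unglue bq.
by case: double_locus_homeo => _ _ h _ _; exact: h.
Qed.

Lemma sc_q_unglue q : sc_base X q -> sc_q (sc_unglue X q) = q.
Proof.
by move=> bq; apply: sc_q_eq => //; have [] := double_locus_unglue bq.
Qed.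

Lemma within_sc_q (T : topologicalType) (A : set T) (f : T -> sc_space X) :
  set_fun A (sc_nbhd X) f -> {within A, continuous f} ->
  {within A, continuous (fun x => sc_q (f x))}.
Proof.
move=> fA cf; have [_ _ cz _] := within_chart fA cf.
case: double_locus_homeo => _ _ _ cg _.
apply: within_comp cg; first by move=> x /fA; exact: double_locus_sc_q.
apply: within_point => //; first by move=> x /fA; exact: chart_range0.
all: exact: within_cst.
Qed.

Lemma within_z_unglue (T : topologicalType) (A : set T) (f : T -> Y) :
  set_fun A (sc_base X) f -> {within A, continuous f} ->
  {within A, continuous (fun x => sc_z (sc_unglue X (f x)))}.
Proof.
move=> fA cf; case: double_locus_homeo => _ _ _ _ cg.
have [] // := within_chart _ (within_comp fA cf cg).
by move=> x /fA/double_locus_unglue[].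
Qed.

End Chart.

(** * The circle action and the phases on the necks *)

Section Necks.
Variables (R : realType) (Y : complexSpace R) (Q : set Y).
Variable X : semistable_chart Q.
Variable theta : R.
Local Notation C := R[i].
Local Notation P := (fixed_phase_circle X theta).

Lemma fixed_phase_circleE : P = sc_base X `*` phase_torsor theta.
Proof.
by apply/seteqP; split=> [p [? ? ? ?]|p [? [? ? ?]]]; split.
Qed.

(** The rotated coordinates [(a u, a^-1 v, z, t)] still satisfy [t = uv] with the
    same moduli, hence are the coordinates of a point of the chart. *)
Lemma neck_actE a x : circle a -> sc_nbhd X x ->
  [/\ sc_nbhd X (neck_act a x), sc_u (neck_act a x) = a * sc_u x,
      sc_v (neck_act a x) = a^-1 * sc_v x, sc_z (neck_act a x) = sc_z x &
      sc_pi (neck_act a x) = sc_pi x].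
Proof.
move=> a1 nx.
have h : chart_range (a * sc_u x, a^-1 * sc_v x, sc_z x, sc_pi x).
  have [/= ux vx zx px] := chart_coords_range nx.
  split => //=.
  - by rewrite normrM a1 mul1r.
  - by rewrite normrM (circleV a1) mul1r.
  - by rewrite mulrACA mulfV ?mul1r //; exact: circle_neq0.
by have [] := chart_coords_point h; split => //; exact: sc_nbhd_point.
Qed.

Lemma sc_q_neck_act a x : circle a -> sc_nbhd X x ->
  sc_q (neck_act a x) = sc_q x.
Proof. by move=> a1 nx; have [_ _ _ h _] := neck_actE a1 nx; rewrite /sc_q h. Qed.

Lemma neck_actM a b x : circle a -> circle b -> sc_nbhd X x ->
  neck_act (a * b) x = neck_act a (neck_act b x).
Proof.
move=> a1 b1 nx; have [_ ub vb zb pb] := neck_actE b1 nx.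
by rewrite {2}/neck_act ub vb zb pb /neck_act !mulrA invfM.
Qed.

Lemma neck_act1 x : sc_nbhd X x -> neck_act 1 x = x.
Proof. by move=> nx; rewrite /neck_act invr1 !mul1r sc_pointK. Qed.

Lemma phases_neck_act a x : circle a -> sc_nbhd X x ->
  phases (neck_act a x) = phase_act a (phases x).
Proof.
move=> a1 nx; have [_ ua va _ _] := neck_actE a1 nx.
rewrite /phases /phase_act /= ua va !normrM a1 (circleV a1) !mul1r.
by rewrite !mulrA.
Qed.

Lemma neck_act_neck rho a x : circle a -> neck X rho theta x ->
  neck X rho theta (neck_act a x).
Proof.
move=> a1 [nx [px ux vx]]; have [na ua va _ pa] := neck_actE a1 nx.
split => //; split; rewrite ?ua ?va ?pa //.
- by rewrite normrM a1 mul1r.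
- by rewrite normrM (circleV a1) mul1r.
Qed.

Lemma neck_phases rho x : 0 < rho -> neck X rho theta x ->
  [/\ phase_torsor theta (phases x),
      sc_u x = (Num.sqrt rho)%:C * (phases x).1 &
      sc_v x = (Num.sqrt rho)%:C * (phases x).2].
Proof.
move=> h [nx [px ux vx]]; have s0 := sqrtC_neq0 h.
have [_ _ _ /= pxE] := chart_coords_range nx.
rewrite /phases /= ux vx; split; last 2 first.
- by rewrite mulrCA divff ?mulr1.
- by rewrite mulrCA divff ?mulr1.
split; rewrite /circle /=.
- by rewrite normf_div ux norm_sqrtC divff.
- by rewrite normf_div vx norm_sqrtC divff.
- rewrite mulf_div -pxE px sqrtCM ?ltW // mulrC mulrA mulVf ?mul1r //.
  by rewrite fmorph_eq0 gt_eqF.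
Qed.

End Necks.

(** * The total space and its identification with [0, r] x P *)

Section TotalSpace.
Variables (R : realType) (Y : complexSpace R) (Q : set Y).
Variable X : semistable_chart Q.
Variables (r theta : R).
Hypotheses (r_gt0 : 0 < r) (r_lt : r < sc_eps X ^+ 2).
Local Notation C := R[i].
Local Notation W := (neck_total X r theta).
Local Notation P := (fixed_phase_circle X theta).

(** At [rho = 0] the last two equations reduce to [u = v = 0] and do not
    constrain the phases: the fixed-phase circle fits in the same description
    as the necks. *)
Lemma neck_totalP w : W w <->
  [/\ 0 <= w.1 <= r, sc_nbhd X w.2.1, phase_torsor theta w.2.2,
      sc_u w.2.1 = (Num.sqrt w.1)%:C * w.2.2.1 &
      sc_v w.2.1 = (Num.sqrt w.1)%:C * w.2.2.2].
Proof.
split.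
  move=> [[rho /= ri [x nx <-]]|[p]].
    move: ri; rewrite in_itv /= => /andP[r0 rr].
    have [? ? ?] := neck_phases r0 nx.
    by split => //=; [rewrite ltW|case: nx].
  rewrite fixed_phase_circleE => -[/= bp tp] <- /=.
  have [nx [u0 v0]] := double_locus_unglue bp.
  by rewrite /circle_incl /= sqrtr0 u0 v0 !mul0r; split; rewrite // lexx ltW.
case: w => rho [x s] /= [/andP[r0 rr] nx ts ux vx].
have [s1 s2 s12] := ts.
move: r0; rewrite le_eqVlt => /predU1P[r0|r0].
  subst rho; right; exists (sc_q x, s).
    by rewrite fixed_phase_circleE; split => //=; exact: sc_q_base.
  rewrite /circle_incl /= unglue_sc_q //; congr (_, (_, _)).
  apply/esym; apply (double_locus_point x); split => //.
  by rewrite /= ux vx sqrtr0 !mul0r.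
left; exists rho; first by rewrite /= in_itv /= r0.
have un : `|sc_u x| = (Num.sqrt rho)%:C.
  by rewrite ux normrM s1 mulr1 norm_sqrtC.
have vn : `|sc_v x| = (Num.sqrt rho)%:C.
  by rewrite vx normrM s2 mulr1 norm_sqrtC.
exists x.
  split => //; split => //; have [_ _ _ /= ->] := chart_coords_range nx.
  by rewrite ux vx mulrACA sqrtCM ?ltW // s12.
rewrite /neck_incl /phases un vn ux vx.
have s0 := sqrtC_neq0 r0.
by rewrite ![_ * _ / _]mulrAC !divff ?mul1r //; case: (s).
Qed.

Lemma neck_total_nbhd : set_fun W (sc_nbhd X) (fun w => w.2.1).
Proof. by move=> w /neck_totalP[]. Qed.

(** Solves the equations of [neck_totalP] for the point of the chart; the value
    of [t] is forced by [t = uv = rho * cis theta]. *)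
Definition circle_to_total (y : R * (Y * (C * C))) :
    R * (sc_space X * (C * C)) :=
  (y.1, (sc_point X ((Num.sqrt y.1)%:C * y.2.2.1, (Num.sqrt y.1)%:C * y.2.2.2,
                     sc_z (sc_unglue X y.2.1), y.1%:C * cis theta), y.2.2)).

(** This is where [r < eps ^ 2] matters: [sqrt rho] must be smaller than the
    radius of the discs of [u] and [v]. *)
Lemma circle_to_total_range y : (`[0, r] `*` P) y ->
  chart_range ((Num.sqrt y.1)%:C * y.2.2.1, (Num.sqrt y.1)%:C * y.2.2.2,
    sc_z (sc_unglue X y.2.1), y.1%:C * cis theta).
Proof.
case: y => rho [q [s1 s2]] /=; rewrite in_itv /= => -[/andP[r0 rr]].
move=> [/= bq h1 h2 h12].
have lt_eps : (Num.sqrt rho)%:C < (sc_eps X)%:C.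
  rewrite ltcR -[ltRHS]ger0_norm ?(ltW (sc_eps_gt0 X)) // -sqrtr_sqr.
  rewrite ltr_sqrt ?exprn_gt0 ?sc_eps_gt0 //; exact: le_lt_trans rr r_lt.
split => /=.
- by rewrite normrM norm_sqrtC h1 mulr1.
- by rewrite normrM norm_sqrtC h2 mulr1.
- have [nx _] := double_locus_unglue bq.
  by have [] := chart_coords_range nx.
- by rewrite mulrACA sqrtCM // h12.
Qed.

(** Both maps are compositions of continuous functions of the chart
    coordinates, even at [rho = 0]: the phases are coordinates of [W], and are
    not computed as [u / |u|]. *)
Lemma total_homeo :
  inverse_homeos W (`[0, r] `*` P) (@total_to_circle R Y Q X) circle_to_total.
Proof.
split.
- split.
    move=> w /neck_totalP[wr nw tw uw vw]; split; first by rewrite /= in_itv.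
    by rewrite fixed_phase_circleE; split=> //=; exact: sc_q_base.
  move=> y yP; have yr := circle_to_total_range yP.
  have [uy vy zy py] := chart_coords_point yr.
  case: yP; rewrite fixed_phase_circleE /= in_itv /= => y0 [yb yt].
  by apply/neck_totalP; split => //; exact: sc_nbhd_point.
- move=> [rho [x s]] /neck_totalP[/= /andP[r0 rr] nx [s1 s2 s12] ux vx].
  rewrite /circle_to_total /total_to_circle /= sc_z_sc_q //.
  rewrite -ux -vx; have [_ _ _ /= px] := chart_coords_range nx.
  have -> : rho%:C * cis theta = sc_pi x.
    by rewrite px ux vx mulrACA sqrtCM // s12.
  by rewrite sc_pointK.
- move=> y yP; have yr := circle_to_total_range yP.
  have [_ _ zy _] := chart_coords_point yr.
  case: (yP); rewrite fixed_phase_circleE => _ [yb _].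
  rewrite /total_to_circle /circle_to_total /= (sc_q_eq _ yb) //.
    by case: (y) => ? [].
  exact: sc_nbhd_point.
- have i := @within_id _ W.
  apply: within_pair (within_fst i) (within_pair _ (within_snd (within_snd i))).
  exact: within_sc_q neck_total_nbhd (within_fst (within_snd i)).
- have i := @within_id _ (`[0, r] `*` P).
  have it := within_snd (within_snd i).
  have ir := within_compT (@real_complex_continuous R)
    (within_compT (@sqrt_continuous R) (within_fst i)).
  apply: within_pair (within_fst i) (within_pair _ it).
  apply: within_point circle_to_total_range _ _ _ _.
  + exact: within_mul ir (within_fst it).
  + exact: within_mul ir (within_snd it).
  + apply: within_z_unglue (within_fst (within_snd i)).
    by move=> y [_ []].
  + have c1 := within_compT (@real_complex_continuous R) (within_fst i).
    exact: within_mul c1 (@within_cst _ _ _ (cis theta)).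
Qed.

Lemma circle_to_total0 p : P p -> circle_to_total (0, p) = circle_incl X p.
Proof.
move=> [bp _ _ _]; rewrite /circle_to_total /circle_incl /= sqrtr0 !mul0r.
by have /double_locus_point[_ <-] := double_locus_unglue bp.
Qed.

Lemma total_act_total a w : circle a -> W w -> W (total_act a w).
Proof.
move=> a1 /neck_totalP[wr nw tw uw vw].
have [na ua va _ _] := neck_actE a1 nw.
apply/neck_totalP; split => //=.
- exact: phase_torsor_act.
- by rewrite ua uw mulrCA.
- by rewrite va vw mulrCA.
Qed.

Lemma total_act_circle_to_total a y : circle a -> (`[0, r] `*` P) y ->
  total_act a (circle_to_total y) = circle_to_total (y.1, circle_act a y.2).
Proof.
move=> a1 yP.
have [uy vy zy py] := chart_coords_point (circle_to_total_range yP).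
rewrite /total_act /neck_act /circle_to_total /= uy vy zy py /=.
by rewrite !(mulrCA a) !(mulrCA a^-1).
Qed.

Lemma total_act_continuous :
  {within (circle : set C) `*` W,
    continuous (fun ax => @total_act R Y Q X ax.1 ax.2)}.
Proof.
have i := @within_id _ ((circle : set C) `*` W).
have ia := within_fst i; have iw := within_snd i.
have iV : {within (circle : set C) `*` W, continuous (fun ax => ax.1^-1)}.
  by apply: within_inv ia => x [/circle_neq0].
have nW : set_fun ((circle : set C) `*` W) (sc_nbhd X) (fun ax => ax.2.2.1).
  by move=> x [_ /neck_total_nbhd].
have [iu iv iz ip] := within_chart nW (within_fst (within_snd iw)).
apply: within_pair (within_fst iw) (within_pair _ _).
  apply: within_point (within_mul ia iu) (within_mul iV iv) iz ip => x xcW.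
  have [ac _] := xcW; have [na ua va za pa] := neck_actE ac (nW _ xcW).
  rewrite -ua -va -za -pa; exact: chart_coords_range.
have it := within_snd (within_snd iw).
exact: within_pair (within_mul ia (within_fst it)) (within_mul iV (within_snd it)).
Qed.

(** * Necks and fixed-phase circle as parts of the total space *)

(** For [rho > 0] the phases are the continuous functions [u / |u|] and
    [v / |v|] of the point of the chart, so that forgetting them is a
    homeomorphism. *)
Lemma neck_family_homeo :
  inverse_homeos
    [set y : R * sc_space X | `]0, r]%classic y.1 /\ neck X y.1 theta y.2]
    (W `&` [set w | 0 < w.1]) (fun y => neck_incl y.1 y.2)
    (fun w => (w.1, w.2.1)).
Proof.
set N := [set y | _].
have rpos y : N y -> 0 < y.1 by rewrite /N /= in_itv => -[/andP[]].
have nW y : N y -> W (neck_incl y.1 y.2).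
  by move=> [yr ny]; left; exists y.1 => //; exists y.2.
have nE w : W w -> 0 < w.1 -> neck X w.1 theta w.2.1 /\ w.2.2 = phases w.2.1.
  move=> [[rho _ [x nx <-]] //|[p _ <-]] /=; by rewrite ltxx.
split.
- split.
    by move=> y ny; split; [exact: nW|exact: rpos].
  move=> w [Ww w0]; split; last by have [] := nE w Ww w0.
  by case/neck_totalP: Ww => /andP[_ wr] _ _ _ _; rewrite /= in_itv /= w0.
- by case.
- by move=> [rho [x s]] [Ww w0]; have [_ /= ->] := nE _ Ww w0.
- have i := @within_id _ N.
  have nN : set_fun N (sc_nbhd X) snd by move=> y [_ []].
  have [cu cv _ _] := within_chart nN (within_snd i).
  have cdiv (f : sc_space X -> C) :
      (forall y, N y -> `|f y.2| = (Num.sqrt y.1)%:C) ->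
      {within N, continuous (fun y => f y.2)} ->
      {within N, continuous (fun y => f y.2 / `|f y.2|)}.
    move=> fn cf; have cn := within_compT (@norm_continuous C C) cf.
    have n0 y : N y -> `|f y.2| != 0.
      by move=> Ny; rewrite fn //; apply/sqrtC_neq0/rpos.
    exact: within_mul cf (within_inv n0 cn).
  apply: within_pair (within_fst i) (within_pair (within_snd i) _).
  by apply: within_pair; [apply: cdiv cu|apply: cdiv cv] => y [_ [_ []]].
- have i := @within_id _ (W `&` [set w | 0 < w.1]).
  exact: within_pair (within_fst i) (within_fst (within_snd i)).
Qed.

(** The slice [rho = 0] of [total_homeo], on which [circle_to_total] is
    [circle_incl]. *)
Lemma circle_incl_homeo :
  inverse_homeos P (W `&` [set w | w.1 = 0]) (circle_incl X)
    (fun w => (sc_q w.2.1, w.2.2)).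
Proof.
have zP : inverse_homeos P ([set 0 : R] `*` P) (fun p => (0, p)) snd.
  split => //.
  - by split=> [p|[? ?] []].
  - by move=> [? ?] [/= -> _].
  - exact: within_pair (@within_cst _ _ _ (0 : R)) (@within_id _ _).
  - exact: within_snd (@within_id _ _).
have lift0 : inverse_homeos ([set 0 : R] `*` P) (W `&` [set w | w.1 = 0])
    circle_to_total (@total_to_circle R Y Q X).
  have [[WP PW] _ _ _ _] := total_homeo.
  have sub : [set 0] `*` P `<=` `[0, r] `*` P.
    by move=> [? ?] [/= -> ?]; split=> //=; rewrite in_itv /= lexx ltW.
  apply: inverse_homeos_restrict (inverse_homeos_sym total_homeo) => //.
  - by move=> y yP; split; [exact/PW/sub|case: yP].
  - by move=> w [/WP[_ wP] w0]; split.
apply: inverse_homeos_eq (inverse_homeos_comp zP lift0) => p.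
exact: circle_to_total0.
Qed.

(** The slice at [rho] of the composition of [neck_family_homeo] with
    [total_homeo]. *)
Lemma neck_homeo rho : `]0, r]%classic rho ->
  homeo_on (neck X rho theta) P (@neck_to_circle R Y Q X).
Proof.
move=> rr; have r0 : 0 < rho by move: rr; rewrite /= in_itv => /andP[].
have [[WP PW] _ _ _ _] := total_homeo.
have pos : inverse_homeos (W `&` [set w | 0 < w.1]) (`]0, r] `*` P)
    (@total_to_circle R Y Q X) circle_to_total.
  apply: inverse_homeos_restrict total_homeo => //.
  - by move=> [s p] [/= + Pp]; rewrite !in_itv /= => /andP[/ltW -> ->].
  - move=> w [/[dup] Ww /WP[wr wP] w0]; split => //.
    by move: wr; rewrite /= !in_itv /= => /andP[_ ->]; rewrite w0.
  - move=> y [yr yP]; split; last by move: yr; rewrite /= in_itv => /andP[].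
    by apply: PW; split=> //; move: yr; rewrite /= !in_itv /= => /andP[/ltW -> ->].
have := inverse_homeos_slice rho (inverse_homeos_comp neck_family_homeo pos).
move=> /(_ (fun _ _ => erefl) (fun _ _ => erefl)) h.
eexists; apply: inverse_homeos_restrict (h).
- by move=> x nx; split.
- by move=> p Pp; split.
- by move=> x nx; have [[+ _] _ _ _ _] := h; case/(_ x) => //; split.
- by move=> p Pp; have [[_ +] _ _ _ _] := h; case/(_ p) => //; split.
Qed.

(** * Bundle structure, coordinates and retraction *)

Lemma total_coords_homeo :
  inverse_homeos W (`[0, r] `*` sc_base X `*` circle)
    (@total_coords R Y Q X)
    (fun y => circle_to_total (y.1.1, (y.1.2, (cis theta / y.2, y.2)))).
Proof.
have h := total_homeo; rewrite fixed_phase_circleE in h.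
exact: inverse_homeos_comp h (inverse_homeos_sym
  (inverse_homeos_fibre `[0, r] (sc_base X) (phase_torsor_homeo theta))).
Qed.

(** The equivariant trivialization: [a] acts on [eta] by [a^-1], so the group
    coordinate has to be [eta^-1] rather than [eta]. *)
Lemma total_trivialization :
  inverse_homeos (`[0, r] `*` sc_base X `*` circle) W
    (fun y => circle_to_total (y.1.1, (y.1.2, (cis theta / y.2^-1, y.2^-1))))
    (fun w => (w.1, sc_q w.2.1, w.2.2.2^-1)).
Proof.
have cV : {within (circle : set C), continuous (fun a => a^-1)}.
  by apply: within_inv (@within_id _ _) => a; exact: circle_neq0.
have h : inverse_homeos (circle : set C) circle (fun a => a^-1) (fun a => a^-1).
  split => //; last 2 first.
  - by move=> a _; exact: invrK.
  - by move=> a _; exact: invrK.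
  - by split=> a; exact: circleV.
have h' := inverse_homeos_comp h (phase_torsor_homeo theta).
have t := inverse_homeos_sym total_homeo; rewrite fixed_phase_circleE in t.
exact: inverse_homeos_comp (inverse_homeos_fibre `[0, r] (sc_base X) h') t.
Qed.

Lemma total_principal_bundle :
  principal_circle_bundle W (`[0, r] `*` sc_base X)
    (@total_proj R Y Q X) (@total_act R Y Q X).
Proof.
have [[WP PW] _ _ cW _] := total_homeo.
have WPE w : W w -> `[0, r]%classic w.1 /\ sc_base X (sc_q w.2.1).
  by move=> /WP[? []].
split.
- by move=> w /WPE[].
- exact: within_pair (within_fst cW) (within_fst (within_snd cW)).
- exact: total_act_total.
- move=> [rho [x s]] /neck_total_nbhd nx.
  by rewrite /total_act /phase_act /= neck_act1 // invr1 !mul1r; case: (s).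
- move=> a b [rho [x s]] a1 b1 /neck_total_nbhd nx.
  by rewrite /total_act /phase_act /= neck_actM // invfM !mulrA.
- exact: total_act_continuous.
- move=> a w a1 /neck_total_nbhd nx.
  by rewrite /total_proj /= sc_q_neck_act.
- move=> b Bb; exists setT; split => //; first exact: openT.
  exists (fun y => circle_to_total (y.1.1, (y.1.2, (cis theta / y.2^-1, y.2^-1)))).
  rewrite preimage_setT !setIT.
  have [[_ TW] TK _ _ _] := total_trivialization.
  split.
  + by eexists; exact: total_trivialization.
  + by move=> y a yB ca; have /(congr1 fst) := TK (y, a) (conj yB ca).
  + move=> y a c [yr yb] ca cc; rewrite total_act_circle_to_total //; last first.
      split => //=; rewrite fixed_phase_circleE; split => //.
      by have [[+ _] _ _ _ _] := phase_torsor_homeo theta; apply; exact: circleV.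
    rewrite /circle_act /phase_act /=; congr (circle_to_total (_, (_, (_, _)))).
      by rewrite !invrK mulrCA.
    by rewrite invfM.
Qed.

(** In [[0, r] x P] this is the homotopy [(rho, p) |-> ((1 - s) * rho, p)],
    which fixes the slice [rho = 0]. *)
Lemma total_deformation_retraction :
  deformation_retraction R W (circle_incl X @` P) (@total_retract R Y Q X).
Proof.
have [[WP PW] WK PK cW cP] := total_homeo.
have zP p : P p -> (`[0, r] `*` P) (0, p).
  by move=> Pp; split => //=; rewrite in_itv /= lexx ltW.
have sP s w : `[0, 1]%classic s -> W w ->
    (`[0, r] `*` P) ((1 - s) * w.1, (total_to_circle w).2).
  move=> + /WP[+ Pw]; rewrite /= !in_itv /= => /andP[s0 s1] /andP[w0 w1].
  split => //=; rewrite mulr_ge0 ?subr_ge0 //=.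
  by apply: le_trans w1; rewrite ler_piMl // lerBlDr lerDl.
split; first by move=> _ [p Pp <-]; rewrite -circle_to_total0 //; exact/PW/zP.
exists (fun sw => circle_to_total ((1 - sw.1) * sw.2.1, (total_to_circle sw.2).2)).
split.
- have i := @within_id _ (`[(0 : R), 1]%classic `*` W).
  have cB : continuous (fun s : R => 1 - s).
    by move=> s; exact: cvgB (cvg_cst _) cvg_id.
  have c1 := within_compT cB (within_fst i).
  have c2 : set_fun (`[(0 : R), 1]%classic `*` W) W snd by move=> x [].
  apply: (within_comp (B := `[0, r] `*` P)) cP.
    by move=> [s w] [/= s01 Ww]; exact: sP.
  apply: within_pair (within_mul c1 (within_fst (within_snd i))) _.
  exact: within_snd (within_comp c2 (within_snd i) cW).
- by move=> [s w] [/= s01 Ww]; exact/PW/sP.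
- by move=> w Ww /=; rewrite subr0 mul1r -[RHS]WK.
- move=> w Ww /=; rewrite subrr mul0r circle_to_total0; last by have [] := WP _ Ww.
  by split => //; exists (total_to_circle w).2 => //; have [] := WP _ Ww.
- move=> s _ s01 [p Pp <-].
  have tE : total_to_circle (circle_incl X p) = (0, p).
    by rewrite -circle_to_total0 // PK //; exact: zP.
  rewrite -[LHS]/(circle_to_total
    ((1 - s) * 0, (total_to_circle (circle_incl X p)).2)).
  by rewrite tE mulr0 circle_to_total0.
Qed.

End TotalSpace.

Theorem lemma3p12 (R : realType) (Y1 : complexSpace R) (Q : set Y1)
    (hQ : is_P1xP1 Q) (X : semistable_chart Q) (theta : R) :
  exists2 r0 : R, 0 < r0 & forall r : R, 0 < r -> r < r0 ->
  let P := fixed_phase_circle X theta in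
  let W := neck_total X r theta in
  [/\ (* W is a principal circle bundle over [0, r] x V *)
      principal_circle_bundle W (`[0, r] `*` sc_base X)
        (@total_proj R Y1 Q X) (@total_act R Y1 Q X),
      (* whose part over ]0, r] is the family of necks and whose part over 0
         is the fixed-phase circle, with their topologies, projections to V
         and circle actions *)
      [/\ homeo_on [set y : R * sc_space X | `]0, r]%classic y.1 /\
                                             neck X y.1 theta y.2]
            (W `&` [set w | 0 < w.1]) (fun y => neck_incl y.1 y.2),
          homeo_on P (W `&` [set w | w.1 = 0]) (circle_incl X),
          forall rho x, `]0, r]%classic rho -> neck X rho theta x ->
            total_proj (neck_incl rho x) = (rho, sc_q x) /\
            forall a, circle a ->
              neck X rho theta (neck_act a x) /\
              total_act a (neck_incl rho x) = neck_incl rho (neck_act a x) &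
          forall p, P p ->
            total_proj (circle_incl X p) = (0, p.1) /\
            forall a, circle a ->
              P (circle_act a p) /\
              total_act a (circle_incl X p) = circle_incl X (circle_act a p)],
      (* each neck is equivariantly homeomorphic to P, over V *)
      forall rho, `]0, r]%classic rho ->
        homeo_on (neck X rho theta) P (@neck_to_circle R Y1 Q X) /\
        forall a x, circle a -> neck X rho theta x ->
          neck_to_circle (neck_act a x) = circle_act a (neck_to_circle x),
      (* and these homeomorphisms, with the identity of P at rho = 0, form a
         continuous family *)
      [/\ homeo_on W (`[0, r] `*` P) (@total_to_circle R Y1 Q X),
          forall rho x, `]0, r]%classic rho -> neck X rho theta x ->
            total_to_circle (neck_incl rho x) = (rho, neck_to_circle x) &
          forall p, P p -> total_to_circle (circle_incl X p) = (0, p)] &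
      (* (rho, q, eta) are coordinates on W, and (rho, q, eta) |-> (0, q, eta)
         is a deformation retraction of W onto P *)
      [/\ homeo_on W (`[0, r] `*` sc_base X `*` circle)
            (@total_coords R Y1 Q X),
          forall w, W w ->
            total_coords (total_retract w) = (0, sc_q w.2.1, w.2.2.2) &
          deformation_retraction R W (circle_incl X @` P)
            (@total_retract R Y1 Q X)]].
Proof.
exists (sc_eps X ^+ 2); first by rewrite exprn_gt0 ?sc_eps_gt0.
move=> r r_gt0 r_lt P W; split.
- exact: total_principal_bundle.
- split.
  + by eexists; exact: neck_family_homeo.
  + by eexists; exact: circle_incl_homeo.
  + move=> rho x _ nx; split=> // a a1; split; first exact: neck_act_neck.
    by case: nx => nx _; rewrite /neck_incl phases_neck_act.
  + move=> p Pp; have bp : sc_base X p.1 by case: Pp.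
    have /double_locus_point[nx xE] := double_locus_unglue bp.
    rewrite /total_proj /= sc_q_unglue //; split=> // a a1; split.
      move: Pp; rewrite /P fixed_phase_circleE => -[_ tp]; split=> //.
      exact: phase_torsor_act.
    have [u0 v0 _ p0] := chart_coords_point (chart_range0 nx).
    rewrite /total_act /circle_incl /=; congr (_, (_, _)).
    by rewrite /neck_act [in RHS]xE; rewrite xE u0 v0 p0 !mulr0 -xE.
- move=> rho rr; split; first exact: neck_homeo rr.
  move=> a x a1 [nx _].
  by rewrite /neck_to_circle sc_q_neck_act // phases_neck_act.
- split=> [||p [bp _ _ _]].
  + by eexists; exact: total_homeo.
  + by [].
  + by rewrite /total_to_circle /= sc_q_unglue //; case: (p).
- split.
  + by eexists; exact: total_coords_homeo.
  + move=> w /(neck_total_nbhd r_gt0) nw.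
    by rewrite /total_coords /= sc_q_unglue //; exact: sc_q_base.
  + exact: total_deformation_retraction.
Qed.
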